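(* For $n\ge1$ let $SCS(n)$ be the number of self-complementary score sequences of length $n$, $SS(n)$ the number of strong score sequences of length $n$, and $SSCS(n)$ the number of score sequences of length $n$ that are both strong and self-complementary; set $SCS(0)=1$. Then for all $n\ge1$, $$SSCS(n)=SCS(n)-\sum_{i=1}^{\lfloor n/2\rfloor} SS(i)\,SCS(n-2i).$$
   Context: A score sequence of length $n\ge1$ is a sequence $(s_1,\dots,s_n)$ of non-negative integers with $s_1\le\cdots\le s_n$, $\sum_{i=1}^r s_i\ge\binom r2$ for $1\le r<n$ and $\sum_{i=1}^n s_i=\binom n2$ (equivalently, the nondecreasing out-degree sequence of a tournament on $n$ vertices). It is strong if $\sum_{i=1}^r s_i>\binom r2$ for all $1\le r<n$, and self-complementary if $s_{n+1-i}=n-1-s_i$ for all $1\le i\le\lfloor n/2\rfloor$ (so the length-1 sequence $(0)$ is self-complementary and $SCS(1)=1$). The empty sequence is regarded as the unique self-complementary score sequence of length $0$, i.e. $SCS(0)=1$. *)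

(* Defs.v *)
From mathcomp Require Import all_boot all_order all_algebra.

Set Implicit Arguments.
Unset Strict Implicit.
Unset Printing Implicit Defensive.

(* Sequences are 0-indexed here: the s_i of the mathematical text, 1 <= i <= n,
   is [nth 0 s i.-1], and s_1 + ... + s_r is [sumn (take r s)]. *)

Definition score_seq (s : seq nat) : bool :=
  [&& sorted leq s,
      [forall r : 'I_(size s), (0 < r) ==> ('C(r, 2) <= sumn (take r s))]
    & sumn s == 'C(size s, 2)].

Definition strong (s : seq nat) : bool :=
  [forall r : 'I_(size s), (0 < r) ==> ('C(r, 2) < sumn (take r s))].

(* With i = j.+1 the condition is s_(n+1-i) = n - 1 - s_i for
   1 <= i <= n./2; the equation is read in int, so that the subtraction is
   not truncated. *)
Definition self_complementary (s : seq nat) : bool :=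
  [forall j : 'I_((size s)./2),
     ((nth 0 s (size s - j.+1))%N%:Z == (size s)%:Z - 1 - (nth 0 s j)%N%:Z)%R].

(* The entries of a score sequence of length n are nonnegative with sum
   'C(n, 2), so bounding them by 'C(n, 2) loses nothing and makes the
   collection finite; see [score_seq_tuple]. *)
Definition num_score_seq (P : pred (seq nat)) (n : nat) : nat :=
  #|[set t : n.-tuple 'I_('C(n, 2).+1) |
      score_seq (map val t) && P (map val t)]|.

Definition SCS (n : nat) : nat := num_score_seq self_complementary n.
Definition SS (n : nat) : nat := num_score_seq strong n.
Definition SSCS (n : nat) : nat :=
  num_score_seq (fun s => strong s && self_complementary s) n.

Lemma score_seq_tuple (s : seq nat) :
  score_seq s -> exists t : (size s).-tuple 'I_('C(size s, 2).+1), map val t = s.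
Proof.
case/and3P=> _ _ /eqP sum_s.
have bnd x : x \in s -> x < 'C(size s, 2).+1.
  move=> xs; rewrite ltnS -sum_s sumnE (perm_big _ (perm_to_rem xs)) /=.
  by rewrite big_cons leq_addr.
have val_inord : map val (map (@inord 'C(size s, 2)) s) = s.
  by rewrite -map_comp -[RHS]map_id; apply/eq_in_map => x /bnd xs; apply: inordK.
by exists (map_tuple (@inord 'C(size s, 2)) (in_tuple s)).
Qed.

Lemma SCS0 : SCS 0 = 1.
Proof.
rewrite /SCS /num_score_seq (_ : [set _ | _] = setT) ?cardsT ?card_tuple //.
apply/setP => t; rewrite !inE tuple0 /score_seq /self_complementary /= andbT.
by apply/andP; split; apply/forallP => -[].
Qed.

(* Main.v *)
(** A self-complementary score sequence s of length n that is not strong has a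
    least r with 0 < r < n and s_1 + ... + s_r = C(r, 2).  Complementation
    sends such a tight index r to n - r, so the least one satisfies 2r <= n.
    Then s splits uniquely as a strong sequence u of length r, a
    self-complementary sequence of length n - 2r shifted up by r, and the
    complement of u, reversed. *)

Require Import Defs.
From mathcomp Require Import all_boot all_order all_algebra.
From mathcomp Require Import zify.

(** * Binomial coefficients and partial sums *)

Lemma bin2S (n : nat) : 'C(n.+1, 2) = 'C(n, 2) + n.
Proof. by rewrite binS bin1. Qed.

Lemma bin2D (m n : nat) : 'C(m + n, 2) = 'C(m, 2) + 'C(n, 2) + m * n.
Proof.
elim: n => [|n IHn]; first by rewrite bin0n addn0 muln0 !addn0.
by rewrite addnS !bin2S IHn mulnS; lia.
Qed.

Lemma sumn_take_nth (s : seq nat) (r : nat) : r < size s ->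
  sumn (take r.+1 s) = sumn (take r s) + nth 0 s r.
Proof. by move=> lt_r; rewrite (take_nth 0) // sumn_rcons. Qed.

Lemma sumn_map_addn (m : nat) (s : seq nat) :
  sumn (map (addn m) s) = m * size s + sumn s.
Proof. by elim: s => [|x s IHs] /=; rewrite ?muln0 // IHs; lia. Qed.

(** * Score sequences and bounds on their entries *)

Lemma score_seqP (s : seq nat) :
  reflect [/\ sorted leq s,
              forall r, r <= size s -> 'C(r, 2) <= sumn (take r s)
            & sumn s = 'C(size s, 2)]
          (score_seq s).
Proof.
apply: (iffP and3P) => [[sorted_s /forallP dom_s /eqP sum_s]|].
  split=> // -[|r]; first by rewrite bin0n.
  rewrite leq_eqVlt => /predU1P[->|lt_r]; first by rewrite take_size sum_s.
  exact: (implyP (dom_s (Ordinal lt_r))).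
move=> [sorted_s dom_s sum_s]; split=> //; last exact/eqP.
by apply/forallP => r; apply/implyP => _; apply: dom_s; apply: ltnW.
Qed.

Lemma strongP (s : seq nat) :
  reflect (forall r, 0 < r < size s -> 'C(r, 2) < sumn (take r s)) (strong s).
Proof.
apply: (iffP forallP) => [str_s r /andP[r_gt0 lt_r]|str_s r].
  exact: (implyP (str_s (Ordinal lt_r))).
by apply/implyP => r_gt0; apply: str_s; rewrite r_gt0 ltn_ord.
Qed.

Lemma self_complementaryP (s : seq nat) :
  reflect (forall j, j < (size s)./2 ->
             (nth 0 s (size s - j.+1) + nth 0 s j).+1 = size s)
          (self_complementary s).
Proof.
apply: (iffP forallP) => [sc_s j lt_j|sc_s j].
  by have /eqP := sc_s (Ordinal lt_j); rewrite /=; lia.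
by have := sc_s j (ltn_ord j); lia.
Qed.

(** Tightness at [i] and domination at [i.+1] force the entry at position [i] to be at least [i];
    sortedness carries the bound on to [j]. *)
Lemma nth_score_seq_ge (s : seq nat) (i j : nat) :
    score_seq s -> sumn (take i s) = 'C(i, 2) -> i <= j < size s ->
  i <= nth 0 s j.
Proof.
case/score_seqP=> sorted_s dom_s _ tight_i /andP[le_ij lt_j].
have lt_i : i < size s by apply: leq_ltn_trans lt_j.
have := dom_s _ lt_i; rewrite sumn_take_nth // tight_i bin2S leq_add2l.
by move/leq_trans; apply; apply: (sorted_leq_nth leq_trans leqnn).
Qed.

(** The last entry is the largest, and domination at [n] bounds it by 'C(n.+1, 2) - 'C(n, 2) = [n],
    where the length is [n.+1]. *)
Lemma score_seq_lt_size (s : seq nat) (x : nat) :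
  score_seq s -> x \in s -> x < size s.
Proof.
move=> sc /(nthP 0)[j lt_j <-]; case/score_seqP: sc => sorted_s dom_s sum_s.
case def_n: (size s) lt_j => [//|n] lt_j.
have lt_n : n < size s by rewrite def_n.
apply: (@leq_ltn_trans (nth 0 s n)).
  by apply: (sorted_leq_nth leq_trans leqnn) => //; rewrite inE /= def_n.
have := dom_s n (ltnW lt_n); have := sumn_take_nth s n lt_n.
by rewrite -def_n take_size sum_s def_n bin2S; lia.
Qed.

(** * Tight indices under complementation *)

(** The last [k] entries pair off with the first [k], each pair summing to [(size s).-1]. *)
Lemma sumn_take_compl (s : seq nat) (k : nat) :
    self_complementary s -> k <= (size s)./2 ->
  sumn (take (size s - k) s) + k * (size s).-1 = sumn s + sumn (take k s).
Proof.
move/self_complementaryP=> sc_s.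
elim: k => [_|k IHk lt_k]; first by rewrite subn0 take_size take0 mul0n.
have := IHk (ltnW lt_k); have := sc_s _ lt_k.
have -> : size s - k = (size s - k.+1).+1 by lia.
by rewrite !sumn_take_nth; lia.
Qed.

Lemma bin2_double (n : nat) : 'C(n, 2) + 'C(n, 2) = n * n.-1.
Proof. by elim: n => // n IHn; rewrite !bin2S; nia. Qed.

(** The relation of [sumn_take_compl] with binomials in place of partial sums; comparing the two
    transfers tightness and domination between [k] and [n - k]. *)
Lemma bin2B (n k : nat) : k <= n -> 'C(n, 2) + 'C(k, 2) = 'C(n - k, 2) + k * n.-1.
Proof.
move=> le_kn; have := bin2_double k.
by rewrite -{1}(subnK le_kn) bin2D; nia.
Qed.

Lemma tight_compl (s : seq nat) (r : nat) :
    score_seq s -> self_complementary s -> r <= size s ->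
    sumn (take r s) = 'C(r, 2) ->
  sumn (take (size s - r) s) = 'C(size s - r, 2).
Proof.
case/score_seqP=> _ _ sum_s sc_s le_r tight_r.
case: (leqP r (size s)./2) => [le_r2|lt_r2].
  by have := sumn_take_compl _ _ sc_s le_r2; have := bin2B _ _ le_r; lia.
(* Past the midpoint, the pairing applies to the complementary index instead. *)
have le_r2 : size s - r <= (size s)./2 by lia.
have := sumn_take_compl _ _ sc_s le_r2; rewrite subKn //.
by have := bin2B _ _ (leq_subr r (size s)); rewrite subKn //; lia.
Qed.

(** Strength of the prefix excludes smaller tight indices, so a positive [i] is the least positive
    tight index. *)
Definition first_tight (i : nat) (s : seq nat) : bool :=
  (sumn (take i s) == 'C(i, 2)) && strong (take i s).

(** Booleans count as 0 or 1: either [s] is strong, or exactly one index up to [n./2] is its least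
    tight index. *)
Lemma sum_first_tight (s : seq nat) (n : nat) : 0 < n -> size s = n ->
    score_seq s -> self_complementary s ->
  strong s + \sum_(1 <= i < n./2.+1) first_tight i s = 1.
Proof.
move=> n_gt0 size_s ss sc.
have [_ dom_s sum_s] := score_seqP _ ss.
have [str_s|/strongP nstr_s] := boolP (strong s).
  rewrite big_nat big1 ?addn0 // => i /andP[i_gt0 lt_i].
  have := strongP _ str_s i; rewrite i_gt0 size_s /first_tight.
  by case: eqP => //= ->; rewrite ltnn; lia.
have [r /and3P[r_gt0 lt_r tight_r] min_r] : exists2 r,
    [&& 0 < r, r < n & sumn (take r s) == 'C(r, 2)] &
    forall q, [&& 0 < q, q < n & sumn (take q s) == 'C(q, 2)] -> r <= q.
  have ex_r : exists r, [&& 0 < r, r < n & sumn (take r s) == 'C(r, 2)].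
    have [/existsP[r r_tight]|/existsPn none] := boolP
      [exists r : 'I_n, [&& 0 < r, r < n & sumn (take r s) == 'C(r, 2)]].
      by exists r.
    case: nstr_s => r /andP[r_gt0]; rewrite size_s => lt_r.
    have := none (Ordinal lt_r); rewrite /= r_gt0 lt_r /=.
    by have := dom_s r; rewrite size_s; lia.
  by exists (ex_minn ex_r); case: ex_minnP.
(* The index [n - r] is tight too, so minimality gives [r <= n - r]. *)
have le_r : r <= n./2.
  suff : r <= n - r by lia.
  by apply: min_r; rewrite -size_s tight_compl ?eqxx //; lia.
rewrite add0n (bigD1_seq r) ?iota_uniq ?mem_index_iota ?r_gt0 //=.
rewrite {1}/first_tight tight_r (introT (strongP _)) => [|q]; last first.
  rewrite size_takel; last by lia.
  move=> /andP[q_gt0 lt_q]; rewrite take_takel; last exact: ltnW.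
  have := dom_s q; have := min_r q; rewrite q_gt0; lia.
rewrite big_nat_cond big1 // => i /andP[/andP[i_gt0 lt_i] ne_ir].
have [/andP[/eqP tight_i /strongP str_i]|//] := boolP (first_tight i s).
(* A second such index would exceed [r], and tightness at [r] would contradict strength of its
   prefix. *)
have lt_ri : r < i.
  by have := min_r i; rewrite i_gt0 tight_i eqxx; lia.
have := str_i r; rewrite size_takel; last by lia.
by rewrite take_takel ?(ltnW lt_ri) // (eqP tight_r) ltnn; lia.
Qed.

(** * Assembling a sequence from its strong prefix and its middle *)

Definition sandwich (u v : seq nat) : seq nat :=
  u ++ map (addn (size u)) v
    ++ rev (map (subn (2 * size u + size v).-1) u).

Lemma size_sandwich (u v : seq nat) : size (sandwich u v) = 2 * size u + size v.
Proof. by rewrite !size_cat size_rev !size_map; lia. Qed.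

Lemma nth_sandwich (u v : seq nat) (j : nat) : j < 2 * size u + size v ->
  nth 0 (sandwich u v) j =
    if j < size u then nth 0 u j
    else if j < size u + size v then size u + nth 0 v (j - size u)
    else (2 * size u + size v).-1 - nth 0 u (2 * size u + size v - j.+1).
Proof.
move=> lt_j; rewrite !nth_cat size_map; case: ltnP => // le_uj.
have -> : (j - size u < size v) = (j < size u + size v) by lia.
case: ltnP => [lt_juv|le_juv]; first by rewrite (nth_map 0) //; lia.
rewrite nth_rev size_map; last by lia.
rewrite (nth_map 0); last by lia.
by congr (_ - nth 0 u _); lia.
Qed.

Lemma take_sandwich_l (u v : seq nat) (r : nat) : r <= size u ->
  take r (sandwich u v) = take r u.
Proof. by move=> le_r; rewrite takel_cat. Qed.

Lemma sumn_take_sandwich (u v : seq nat) (k : nat) : k <= size v ->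
  sumn (take (size u + k) (sandwich u v)) = sumn u + (size u * k + sumn (take k v)).
Proof.
move=> le_k; rewrite takeD sumn_cat take_size_cat // drop_size_cat //.
by rewrite takel_cat ?size_map // -map_take sumn_map_addn size_takel.
Qed.

Lemma self_complementary_sandwich (u v : seq nat) :
    score_seq u -> self_complementary v -> self_complementary (sandwich u v).
Proof.
move=> su /self_complementaryP scv; apply/self_complementaryP => j.
rewrite size_sandwich => lt_j; rewrite !nth_sandwich; try lia.
case: (ltnP j (size u)) => [lt_ju|le_uj].
  (* This bound keeps the subtraction in the third block from truncating. *)
  have lt_x : nth 0 u j < size u by apply/(score_seq_lt_size _ _ su)/mem_nth.
  rewrite !ifF; try lia.
  have -> : 2 * size u + size v - (2 * size u + size v - j.+1).+1 = j by lia.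
  by lia.
rewrite ifF ?ifT; try lia.
have := scv (j - size u).
have -> : size v - (j - size u).+1 = 2 * size u + size v - j.+1 - size u by lia.
by lia.
Qed.

Lemma sumn_sandwich (u v : seq nat) : score_seq u -> score_seq v ->
  sumn (sandwich u v) = 'C(2 * size u + size v, 2).
Proof.
move=> su sv; have lt_u := score_seq_lt_size _ _ su.
have [_ _ sum_u] := score_seqP _ su; have [_ _ sum_v] := score_seqP _ sv.
set N := 2 * size u + size v.
(* The two outer blocks cancel entry by entry, whatever the sum of [u]. *)
have sum_compl : sumn u + sumn (map (subn N.-1) u) = size u * N.-1.
  have : {in u, forall x, x <= N.-1} by move=> x /lt_u; lia.
  elim: (u) => [//|x w IHw] le_w /=; rewrite mulSn.
  have := le_w _ (mem_head _ _); have := IHw (sub_in1 _ le_w) => /=.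
  by move=> IH le_x; rewrite -IH; [lia|move=> y; rewrite inE orbC => ->].
rewrite !sumn_cat sumn_rev sumn_map_addn -/N sum_v.
have def_compl : size u * N.-1
               = size u * (size u).-1 + size u * size u + size u * size v.
  by rewrite -!mulnDr /N; case: (size u) => [|k]; rewrite ?mul0n //; congr (_ * _); lia.
rewrite /N mul2n -addnn !bin2D mulnDl addnn -mul2n -/N.
by have := bin2_double (size u); lia.
Qed.

(** With a = [size u] and b = [size v], the blocks take values below a, in [a, a + b) and from a + b
    on, hence sortedness. Domination is checked according to the block in which [r] falls. *)
Lemma score_seq_sandwich (u v : seq nat) :
    score_seq u -> score_seq v -> self_complementary v ->
  score_seq (sandwich u v).
Proof.
move=> su sv scv; have sum_s := sumn_sandwich _ _ su sv.
have scs := self_complementary_sandwich _ _ su scv.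
have [sorted_u dom_u sum_u] := score_seqP _ su.
have [sorted_v dom_v _] := score_seqP _ sv.
have lt_u := score_seq_lt_size _ _ su; have lt_v := score_seq_lt_size _ _ sv.
apply/score_seqP; split; last by rewrite size_sandwich.
  rewrite /sandwich (sorted_pairwise leq_trans) !pairwise_cat allrel_catr.
  rewrite -!(sorted_pairwise leq_trans) sorted_u rev_sorted !sorted_map.
  have -> : sorted (relpre (addn (size u)) leq) v.
    by rewrite (eq_sorted (e' := leq)) // => x y /=; rewrite leq_add2l.
  have -> : sorted (relpre (subn (2 * size u + size v).-1) geq) u.
    by apply: sub_sorted sorted_u => x y /= le_xy; lia.
  rewrite /= !andbT -andbA; apply/and3P; split; apply/allrelP => x y.
  - by move=> /lt_u lt_x /mapP[z _ ->]; lia.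
  - by move=> /lt_u lt_x; rewrite mem_rev => /mapP[z /lt_u lt_z ->]; lia.
  by move=> /mapP[z /lt_v lt_z ->]; rewrite mem_rev => /mapP[t /lt_u lt_t ->]; lia.
move=> r; rewrite size_sandwich => le_r.
case: (leqP r (size u)) => [le_ru|lt_ur]; first by rewrite take_sandwich_l ?dom_u.
case: (leqP r (size u + size v)) => [le_ruv|lt_uvr].
  have le_rv : r - size u <= size v by lia.
  have -> : r = size u + (r - size u) by lia.
  rewrite sumn_take_sandwich // bin2D sum_u; have := dom_v _ le_rv; lia.
(* In the third block, complementation reduces domination at [r] to domination of [u] at [N - r]. *)
set N := 2 * size u + size v in le_r sum_s *.
have le_k : N - r <= size u by lia.
have := sumn_take_compl _ (N - r) scs; have := dom_u _ le_k.
have := bin2B N (N - r) (leq_subr _ _).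
by rewrite size_sandwich -/N subKn // (take_sandwich_l _ _ _ le_k) sum_s; lia.
Qed.

(** * Recovering the two pieces *)

Definition middle (i : nat) (s : seq nat) : seq nat :=
  map (subn^~ i) (take (size s - 2 * i) (drop i s)).

Lemma size_middle (i : nat) (s : seq nat) : size (middle i s) = size s - 2 * i.
Proof. by rewrite size_map size_take_min size_drop; lia. Qed.

Lemma middle_sandwich (u v : seq nat) : middle (size u) (sandwich u v) = v.
Proof.
rewrite /middle size_sandwich addKn drop_size_cat // take_size_cat ?size_map //.
by rewrite -map_comp -[RHS]map_id; apply: eq_map => x /=; rewrite addKn.
Qed.

Lemma sandwich_middle (i : nat) (s : seq nat) :
    score_seq s -> self_complementary s -> i <= (size s)./2 ->
    sumn (take i s) = 'C(i, 2) ->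
  sandwich (take i s) (middle i s) = s.
Proof.
move=> ss /self_complementaryP sc le_i tight_i.
have size_u : size (take i s) = i by rewrite size_takel //; lia.
have size_s : 2 * size (take i s) + size (middle i s) = size s.
  by rewrite size_u size_middle; lia.
apply: (@eq_from_nth _ 0) => [|j]; first by rewrite size_sandwich.
rewrite size_sandwich size_s => lt_j; rewrite nth_sandwich size_s // size_u.
rewrite size_middle; case: (ltnP j i) => [lt_ji|le_ij]; first by rewrite nth_take.
case: ifP => [lt_jn|ge_jn].
  rewrite (nth_map 0) ?nth_take ?nth_drop ?size_take_min ?size_drop; try lia.
  (* Tightness at [i] makes these entries at least [i], so shifting down and up again loses
     nothing. *)
  rewrite subnKC // subnKC //; apply: nth_score_seq_ge => //; lia.
rewrite nth_take; last by lia.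
(* The mirror image of position [j] lies in the first block. *)
have := sc (size s - j.+1).
have -> : size s - (size s - j.+1).+1 = j by lia.
by lia.
Qed.

Lemma score_seq_take (i : nat) (s : seq nat) :
    score_seq s -> i <= size s -> sumn (take i s) = 'C(i, 2) ->
  score_seq (take i s).
Proof.
case/score_seqP=> sorted_s dom_s _ le_i tight_i.
apply/score_seqP; rewrite size_takel //; split=> // [|r le_r].
  exact: take_sorted.
by rewrite take_takel // dom_s // (leq_trans le_r).
Qed.

Lemma score_seq_sandwich_inv (u v : seq nat) :
    score_seq u -> score_seq (sandwich u v) -> self_complementary (sandwich u v) ->
  score_seq v.
Proof.
move=> su ss sc; have [_ _ sum_u] := score_seqP _ su.
have [sorted_s dom_s _] := score_seqP _ ss.
have tight_u : sumn (take (size u) (sandwich u v)) = 'C(size u, 2).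
  by rewrite take_sandwich_l // take_size.
apply/score_seqP; split.
- have := drop_sorted (size u) sorted_s; rewrite drop_size_cat //.
  move/(take_sorted (size v)); rewrite take_size_cat ?size_map // sorted_map.
  by rewrite (eq_sorted (e' := leq)) // => x y /=; rewrite leq_add2l.
- move=> r le_r; have := dom_s (size u + r).
  by rewrite size_sandwich sumn_take_sandwich // bin2D sum_u; lia.
(* The complementary index [size u + size v] is tight as well, which determines the sum of [v]. *)
have := tight_compl _ _ ss sc _ tight_u; rewrite size_sandwich.
have -> : 2 * size u + size v - size u = size u + size v by lia.
by rewrite sumn_take_sandwich // take_size bin2D sum_u; lia.
Qed.

Lemma self_complementary_sandwich_inv (u v : seq nat) :
  self_complementary (sandwich u v) -> self_complementary v.
Proof.
move/self_complementaryP=> sc; apply/self_complementaryP => j lt_j.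
have := sc (size u + j); rewrite size_sandwich !nth_sandwich; try lia.
rewrite addKn; do 2!(rewrite ifF; last lia; rewrite ifT; last lia).
have -> : 2 * size u + size v - (size u + j).+1 - size u = size v - j.+1 by lia.
by lia.
Qed.

(** * Enumeration and counting *)

(** Listing plain sequences of naturals removes the ordinal bound, which varies with [n], so that
    different lengths can be combined. *)
Definition score_seqs (P : pred (seq nat)) (n : nat) : seq (seq nat) :=
  [seq map val (tval t)
     | t <- enum [set t : n.-tuple 'I_('C(n, 2).+1) |
                   score_seq (map val t) && P (map val t)]].

Lemma size_score_seqs (P : pred (seq nat)) (n : nat) :
  size (score_seqs P n) = num_score_seq P n.
Proof. by rewrite size_map -cardE. Qed.

Lemma score_seqs_uniq (P : pred (seq nat)) (n : nat) : uniq (score_seqs P n).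
Proof.
rewrite map_inj_uniq ?enum_uniq // => t1 t2 eq_t.
by apply/val_inj/(inj_map val_inj).
Qed.

Lemma mem_score_seqs (P : pred (seq nat)) (n : nat) (s : seq nat) :
  (s \in score_seqs P n) = [&& size s == n, score_seq s & P s].
Proof.
apply/mapP/and3P => [[t]|[/eqP <- ss Ps]].
  by rewrite mem_enum inE => /andP[st Pt] ->; rewrite size_map size_tuple.
have [t def_t] := score_seq_tuple ss.
by exists t; rewrite // mem_enum inE def_t ss.
Qed.

(** [sandwich] is a bijection from pairs (strong of length [i], self-complementary of length
    [n - 2 * i]) onto the sequences counted. *)
Lemma count_first_tight (n i : nat) : 0 < i <= n./2 ->
  count (first_tight i) (score_seqs self_complementary n)
    = SS i * SCS (n - 2 * i).
Proof.
move=> /andP[i_gt0 le_i]; rewrite /SS /SCS -!size_score_seqs -size_filter.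
rewrite -(size_allpairs sandwich); apply/perm_size/uniq_perm.
- exact/filter_uniq/score_seqs_uniq.
- apply: allpairs_uniq; try exact: score_seqs_uniq.
  move=> [u1 v1] [u2 v2] /allpairsP[[a b] /= [+ _ [-> ->]]].
  rewrite mem_score_seqs => /and3P[/eqP size_a _ _] /allpairsP[[c d] /= [+ _ [-> ->]]].
  rewrite mem_score_seqs => /and3P[/eqP size_c _ _] eq_s.
  (* Injectivity: the prefix of length [i] determines the first component, then [middle] the
     second. *)
  have eq_ac : a = c.
    by rewrite -(take_size a) -(take_sandwich_l a b) // eq_s size_a -size_c
               take_sandwich_l // take_size.
  by rewrite -(middle_sandwich a b) eq_s eq_ac middle_sandwich.
move=> s; rewrite mem_filter mem_score_seqs.
apply/idP/allpairsP => [|[[u v] /= [+ + ->]]].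
  case/and4P=> /andP[/eqP tight_i str_i] /eqP size_s ss sc.
  have def_s := sandwich_middle i _ ss sc.
  rewrite size_s in def_s; have {}def_s := def_s le_i tight_i.
  have su : score_seq (take i s) by apply: score_seq_take => //; lia.
  exists (take i s, middle i s); split=> //=; rewrite mem_score_seqs.
    by rewrite su str_i size_takel ?eqxx //; lia.
  rewrite size_middle size_s eqxx.
  rewrite (score_seq_sandwich_inv _ _ su) ?def_s //.
  by rewrite (self_complementary_sandwich_inv (take i s)) ?def_s.
rewrite !mem_score_seqs => /and3P[/eqP size_u su str_u] /and3P[/eqP size_v sv scv].
rewrite score_seq_sandwich // self_complementary_sandwich // size_sandwich.
rewrite /first_tight take_sandwich_l ?size_u // -size_u take_size str_u.
by have [_ _ ->] := score_seqP _ su; rewrite eqxx size_v; lia.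
Qed.

(** Sum the identity [sum_first_tight] over all self-complementary score sequences of length [n]. *)
Lemma SCS_decomposition (n : nat) : 0 < n ->
  SCS n = SSCS n + \sum_(1 <= i < n./2.+1) SS i * SCS (n - 2 * i).
Proof.
move=> n_gt0; set L := score_seqs self_complementary n.
have <- : count strong L = SSCS n.
  rewrite /SSCS -size_score_seqs -size_filter; apply/perm_size/uniq_perm.
  - exact/filter_uniq/score_seqs_uniq.
  - exact: score_seqs_uniq.
  by move=> s; rewrite mem_filter !mem_score_seqs; case: strong; rewrite ?andbF.
have -> : \sum_(1 <= i < n./2.+1) SS i * SCS (n - 2 * i)
        = \sum_(1 <= i < n./2.+1) count (first_tight i) L.
  by apply: eq_big_nat => i i_range; rewrite count_first_tight.
rewrite /SCS -size_score_seqs -/L -sum1_size.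
under [X in _ + X]eq_bigr do rewrite -sumn_count sumnE big_map.
(* Exchanging the sums leaves one identity per sequence. *)
rewrite exchange_big -sumn_count sumnE big_map -big_split /=.
rewrite big_seq [RHS]big_seq; apply: eq_bigr => s.
rewrite mem_score_seqs => /and3P[/eqP size_s ss sc].
by rewrite (sum_first_tight _ _ n_gt0 size_s).
Qed.

Theorem theorem13 (n : nat) (hn : (1 <= n)%N) :
  ((SSCS n)%:Z =
     (SCS n)%:Z - \sum_(1 <= i < n./2.+1) (SS i)%:Z * (SCS (n - 2 * i))%:Z)%R.
Proof.
rewrite (SCS_decomposition _ hn) PoszD (big_morph Posz PoszD (erefl _)).
under [X in (_ + X - _)%R]eq_bigr do rewrite PoszM.
by rewrite GRing.addrK.
Qed.
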